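(* Let $n\ge 3$ and let $O_n$ be the simplicial annulus defined in the context. Then the Smith normal form of the second Laplacian matrix $L^2(O_n)$ is $$I_{3n}\oplus 3I_{3n-2}\oplus\operatorname{diag}(18n,0),$$ where $I_m$ denotes the $m\times m$ identity matrix and $\oplus$ denotes the block-diagonal direct sum of matrices.
   Context: A simplicial complex $\Sigma$ is described by a pair $(G,\mathcal C)$, where $G$ is its 1-skeleton (a graph) and $\mathcal C$ is the set of allowed cliques of $G$, i.e. the cliques of $G$ that are simplices of $\Sigma$ ($\mathcal C$ is closed under taking nonempty subsets). A $d$-clique is a clique with $d$ vertices. Two distinct $d$-cliques $\alpha,\alpha'\in\mathcal C$ are adjacent if there is a $(d+1)$-clique $\beta\in\mathcal C$ containing both. The degree $\deg(\alpha)$ of a $d$-clique $\alpha\in\mathcal C$ is the number of $d$-cliques of $\mathcal C$ adjacent to it. If $\alpha_1,\dots,\alpha_{c_d}$ are the $d$-cliques of $\mathcal C$, the $d$-adjacency matrix $A^d(\Sigma)$ is the $c_d\times c_d$ matrix with $(i,j)$-entry $1$ if $\alpha_i$ and $\alpha_j$ are adjacent and $0$ otherwise, and the $d$-th Laplacian matrix is $L^d(\Sigma)=\operatorname{diag}(\deg(\alpha_1),\dots,\deg(\alpha_{c_d}))-A^d(\Sigma)$. The simplicial annulus $O_n$ ($n\ge3$): its 1-skeleton consists of two disjoint cycles $C_n$ and $C_{2n}$ with vertex sets $\{v_0,\dots,v_{n-1}\}$ and $\{u_0,\dots,u_{2n-1}\}$ (in cyclic order), together with, for each $i\in\{0,\dots,n-1\}$,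 edges from $v_i$ to $u_{2i-1}$, $u_{2i}$ and $u_{2i+1}$. Indices of the $u$'s are taken modulo $2n$ and indices of the $v$'s modulo $n$. The allowed 3-cliques are exactly $\{v_i,u_{2i-1},u_{2i}\}$, $\{v_i,u_{2i},u_{2i+1}\}$ and $\{v_i,v_{i+1},u_{2i+1}\}$ for $i\in\{0,\dots,n-1\}$; all vertices and edges of the 1-skeleton are allowed, and there are no allowed cliques of size larger than 3. The Smith normal form of an integer matrix $M$ is the unique diagonal matrix $\operatorname{diag}(f_1,\dots,f_r,0,\dots,0)$ with positive $f_i$, $f_i\mid f_j$ for $i<j$, $r=\operatorname{rank}(M)$, of the form $PMQ$ with $P,Q$ integer unimodular matrices. *)

(* Defs.v *)
From HB Require Import structures.
From mathcomp Require Import all_boot all_order all_algebra.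
From mathcomp Require Import zify.

Set Implicit Arguments.
Unset Strict Implicit.
Unset Printing Implicit Defensive.

Import Order.TTheory GRing.Theory Num.Theory.
Local Open Scope ring_scope.

Definition is_clique (V : finType) (e : rel V) (s : {set V}) : bool :=
  [forall x in s, forall y in s, (x != y) ==> e x y].

(* All elements of V are vertices of the complex (sc_vertex), and the graph is
   exactly the 1-skeleton (sc_allowedP and sc_edge). *)
Record simplicial_complex (V : finType) := SimplicialComplex {
  skel : rel V;
  allowed : {set {set V}};
  skel_sym : symmetric skel;
  skel_irr : irreflexive skel;
  sc_allowedP : forall s, s \in allowed -> (s != set0) && is_clique skel s;
  sc_down : forall s t : {set V},
    s \in allowed -> t \subset s -> t != set0 -> t \in allowed;
  sc_vertex : forall x, [set x] \in allowed;
  sc_edge : forall x y, skel x y -> [set x; y] \in allowed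
}.

Section Laplacian.
Variables (V : finType) (S : simplicial_complex V) (d : nat).

Definition cliques : {set {set V}} := [set s in allowed S | #|s| == d].

Definition clique_adj (a b : {set V}) : bool :=
  [&& a != b & [exists s in allowed S,
                  [&& #|s| == d.+1, a \subset s & b \subset s]]].

Definition clique_deg (a : {set V}) : nat :=
  #|[set b in cliques | clique_adj a b]|.

Definition enumerates (c : nat) (alpha : c.-tuple {set V}) : Prop :=
  uniq alpha /\ alpha =i cliques.

Definition adjacency_mx (c : nat) (alpha : c.-tuple {set V}) : 'M[int]_c :=
  \matrix_(i, j) (clique_adj (tnth alpha i) (tnth alpha j))%:R.

Definition laplacian_mx (c : nat) (alpha : c.-tuple {set V}) : 'M[int]_c :=
  diag_mx (\row_i (clique_deg (tnth alpha i))%:R) - adjacency_mx alpha.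

End Laplacian.

(* Over int, unitmx is the set of matrices of determinant 1 or -1. *)
Definition is_smith_normal_form (m n : nat) (M D : 'M[int]_(m, n)) : Prop :=
  exists f : seq int,
    [/\ size f = \rank (map_mx intr M : 'M[rat]_(m, n)),
        forall i, (i < size f)%N -> 0 < f`_i,
        forall i j, (i < j)%N -> (j < size f)%N -> (f`_i %| f`_j)%Z,
        D = \matrix_(i, j) (f`_i *+ (i == j :> nat))
      & exists P : 'M[int]_m, exists Q : 'M[int]_n,
          [/\ P \in unitmx, Q \in unitmx & D = P *m M *m Q]].

Definition dsum_mx (R : pzRingType) (m n : nat) (A : 'M[R]_m) (B : 'M[R]_n) :
  'M[R]_(m + n) := block_mx A 0 0 B.

Section Annulus.
Variable n : nat.

Lemma dbl_ord_subproof (i : 'I_n) : (2 * i < 2 * n)%N.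
Proof. by rewrite ltn_pmul2l. Qed.

Definition dbl_ord (i : 'I_n) : 'I_(2 * n) := Ordinal (dbl_ord_subproof i).

Definition annulus_vertex : finType := ('I_n + 'I_(2 * n))%type.

Definition av (i : 'I_n) : annulus_vertex := inl i.
Definition au (j : 'I_(2 * n)) : annulus_vertex := inr j.

(* ordS and ord_pred are the cyclic successor and predecessor, so indices are
   taken modulo n for the v's and modulo 2n for the u's. *)
Definition annulus_arc (x y : annulus_vertex) : bool :=
  match x, y with
  | inl i, inl i' => i' == ordS i
  | inr j, inr j' => j' == ordS j
  | inl i, inr j => [|| j == ord_pred (dbl_ord i), j == dbl_ord i
                      | j == ordS (dbl_ord i)]
  | inr _, inl _ => false
  end.

Definition annulus_graph : rel annulus_vertex :=
  fun x y => annulus_arc x y || annulus_arc y x.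

Definition annulus_triangles : {set {set annulus_vertex}} :=
  [set [set av i; au (ord_pred (dbl_ord i)); au (dbl_ord i)] | i : 'I_n]
  :|: [set [set av i; au (dbl_ord i); au (ordS (dbl_ord i))] | i : 'I_n]
  :|: [set [set av i; av (ordS i); au (ordS (dbl_ord i))] | i : 'I_n].

Definition annulus_edges : {set {set annulus_vertex}} :=
  [set s | [exists x, exists y, annulus_graph x y && (s == [set x; y])]].

Definition annulus_allowed : {set {set annulus_vertex}} :=
  [set [set x] | x : annulus_vertex] :|: annulus_edges :|: annulus_triangles.

Lemma annulus_graph_sym : symmetric annulus_graph.
Proof. by move=> x y; rewrite /annulus_graph orbC. Qed.

Lemma ordS_neq m (i : 'I_m) : (1 < m)%N -> ordS i != i.
Proof.
move=> m1; rewrite -val_eqE /=; have im := ltn_ord i.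
have [e|ne] := eqVneq i.+1 m; last by rewrite modn_small //; lia.
have -> : (i.+1 %% m = 0)%N by rewrite e modnn.
lia.
Qed.

Hypothesis n_ge3 : (3 <= n)%N.

Lemma annulus_graph_irr : irreflexive annulus_graph.
Proof.
move=> [i|j]; rewrite /annulus_graph /= orbb eq_sym; apply/negbTE/ordS_neq; lia.
Qed.

Lemma dbl_ordS (i : 'I_n) : ordS (dbl_ord i) = ord_pred (dbl_ord (ordS i)).
Proof.
suff -> : dbl_ord (ordS i) = ordS (ordS (dbl_ord i)) by rewrite ordSK.
apply: val_inj => /=; rewrite muln_modr -[in RHS]addn1 modnDml; congr (_ %% _)%N.
lia.
Qed.

Lemma annulus_triangleP s : s \in annulus_triangles ->
  exists x y z, [/\ s = [set x; y; z], annulus_graph x y,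
                    annulus_graph x z & annulus_graph y z].
Proof.
rewrite !inE -orbA => /or3P[] /imsetP[i _ ->].
- exists (av i), (au (ord_pred (dbl_ord i))), (au (dbl_ord i)).
  by split; rewrite // /annulus_graph /= ?ord_predK ?eqxx ?orbT.
- exists (av i), (au (dbl_ord i)), (au (ordS (dbl_ord i))).
  by split; rewrite // /annulus_graph /= ?eqxx ?orbT.
exists (av i), (av (ordS i)), (au (ordS (dbl_ord i))).
by split; rewrite // /annulus_graph /= -?dbl_ordS ?eqxx ?orbT.
Qed.

Lemma annulus_allowedP s : s \in annulus_allowed ->
  (s != set0) && is_clique annulus_graph s.
Proof.
have sy := annulus_graph_sym.
rewrite 2!in_setU -orbA => /or3P[/imsetP[x _ ->]||].
- apply/andP; split; first by apply/set0Pn; exists x; rewrite inE.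
  apply/forall_inP => a /set1P ->; apply/forall_inP => b /set1P ->.
  by rewrite eqxx.
- rewrite inE => /existsP[x /existsP[y /andP[xy /eqP ->]]].
  apply/andP; split; first by apply/set0Pn; exists x; rewrite !inE eqxx.
  apply/forall_inP => a /set2P[] ->; apply/forall_inP => b /set2P[] ->;
    by rewrite ?eqxx // ?xy ?implybT // sy xy implybT.
move=> /annulus_triangleP[x [y [z [-> xy xz yz]]]].
apply/andP; split; first by apply/set0Pn; exists x; rewrite !inE eqxx.
apply/forall_inP => a; rewrite !inE -orbA => /or3P[] /eqP ->;
  apply/forall_inP => b; rewrite !inE -orbA => /or3P[] /eqP ->;
  by rewrite ?eqxx // ?xy ?xz ?yz ?implybT // sy ?xy ?xz ?yz implybT.
Qed.

Lemma annulus_allowed1 x : [set x] \in annulus_allowed.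
Proof. by rewrite 2!in_setU imset_f. Qed.

Lemma annulus_allowed2 x y :
  annulus_graph x y -> [set x; y] \in annulus_allowed.
Proof.
move=> xy; rewrite !in_setU; apply/orP; left; apply/orP; right.
by rewrite inE; apply/existsP; exists x; apply/existsP; exists y; rewrite xy /=.
Qed.

Lemma annulus_down (s t : {set annulus_vertex}) : s \in annulus_allowed ->
  t \subset s -> t != set0 -> t \in annulus_allowed.
Proof.
move=> sA ts t0; have /andP[_ scl] := annulus_allowedP sA.
have [-> //|tNs] := eqVneq t s.
have tps : t \proper s by rewrite properEneq tNs.
have s3 : (#|s| <= 3)%N.
  move: sA; rewrite 2!in_setU -orbA => /or3P[/imsetP[x _ ->]||].
  - by rewrite cards1.
  - rewrite inE => /existsP[x /existsP[y /andP[_ /eqP ->]]].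
    by rewrite cards2; case: (x != y).
  move=> /annulus_triangleP[x [y [z [-> _ _ _]]]].
  by rewrite -setUA cardsU1 cards2; case: (x \notin _); case: (y != z).
have t2 : (#|t| < 3)%N by apply: leq_trans s3; apply: proper_card.
have [t1|t1] := leqP #|t| 1.
  have /cards1P[x ->] : #|t| == 1 by rewrite eqn_leq t1 card_gt0.
  exact: annulus_allowed1.
have /cards2P[x [y [xy tE]]] : #|t| == 2 by rewrite eqn_leq -ltnS t2.
rewrite tE; apply: annulus_allowed2.
have xs : x \in s by apply: (subsetP ts); rewrite tE !inE eqxx.
have ys : y \in s by apply: (subsetP ts); rewrite tE !inE eqxx orbT.
have /forall_inP/(_ y ys) := forall_inP scl x xs.
by rewrite xy.
Qed.

Definition annulus : simplicial_complex annulus_vertex :=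
  SimplicialComplex annulus_graph_sym annulus_graph_irr annulus_allowedP
    annulus_down annulus_allowed1 annulus_allowed2.

End Annulus.

(* Main.v *)
Require Import Defs.
From mathcomp Require Import all_boot all_order all_algebra.
From mathcomp Require Import perm zify ring.
Import Order.TTheory GRing.Theory Num.Theory.
Local Open Scope ring_scope.

Set Implicit Arguments.
Unset Strict Implicit.
Unset Printing Implicit Defensive.

(** The triangles of the annulus, taken in the order in which one meets them
    while going around, form a cyclic strip: with N = 3n, each of the N
    triangles shares one edge (a spoke, joining the two boundary cycles) with
    the preceding triangle and one with the following triangle, and its third
    edge (a rim edge) lies on the boundary. So there are N spokes s_k and N rim
    edges b_k, the triangle t_k has the edges s_k, s_(k+1) and b_k, and this
    incidence pattern determines the second Laplacian
    ([annulus_cyclic_strip], [laplacian_mx_ueq_strip]). With S the cyclic shift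
    matrix of size N, ordering the spokes before the rim edges gives

      L = [ 4 - S - S^T   -(1 + S^T) ]
          [ -(1 + S)          2      ].

    It remains to diagonalise L over the integers. Because S S^T = 1, block
    operations with circulant blocks turn L into
    [ C  2 ; 0  3C ] with C = S^T - 1 ([strip_laplacian_ueq_circulant]). The
    matrix C has corank one, its left kernel is spanned by the all-ones vector,
    and its Smith form is E = diag(1, ..., 1, 0) = U C V. Multiplying both block
    rows by U and both block columns by V gives [ E  2UV ; 0  3E ], and the copy
    of E in the corner clears every row of 2UV but the last one. The last row of
    UV is the all-ones vector expressed in the new coordinates, and U and V are
    chosen to make it (0, ..., 0, -1, N)
    ([strip_laplacian_ueq_last_row]). Everything then splits into pairs (1, 3),
    apart from the last two coordinates of each block, where the relations
    reduce to the matrix [ -2  2N ; 3  0 ], whose invariants are 1 and 6N = 18n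
    ([strip_laplacian_ueq_diag]). The invariants are thus N times 1, N - 2 times
    3, then 6N and 0. *)

(** * Unimodular equivalence of integer matrices *)

Definition unimodular_equiv m n (A B : 'M[int]_(m, n)) :=
  exists P Q, [/\ P \in unitmx, Q \in unitmx & B = P *m A *m Q].

Lemma ueq_refl m n (A : 'M[int]_(m, n)) : unimodular_equiv A A.
Proof. by exists 1%:M, 1%:M; rewrite !unitmx1 mul1mx mulmx1. Qed.

Lemma ueq_trans m n (A B C : 'M[int]_(m, n)) :
  unimodular_equiv A B -> unimodular_equiv B C -> unimodular_equiv A C.
Proof.
move=> [P [Q [uP uQ ->]]] [P' [Q' [uP' uQ' ->]]].
exists (P' *m P), (Q *m Q'); rewrite !unitmx_mul uP uQ uP' uQ'.
by rewrite !mulmxA.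
Qed.

Lemma ueq_mull m n (P : 'M_m) (A : 'M[int]_(m, n)) :
  P \in unitmx -> unimodular_equiv A (P *m A).
Proof. by move=> uP; exists P, 1%:M; rewrite unitmx1 mulmx1. Qed.

Lemma ueq_mulr m n (Q : 'M_n) (A : 'M[int]_(m, n)) :
  Q \in unitmx -> unimodular_equiv A (A *m Q).
Proof. by move=> uQ; exists 1%:M, Q; rewrite unitmx1 mul1mx. Qed.

Lemma unitmx_ublock m n (A : 'M[int]_m) (X : 'M_(m, n)) (D : 'M_n) :
  A \in unitmx -> D \in unitmx -> block_mx A X 0 D \in unitmx.
Proof. by move=> uA uD; rewrite unitmxE det_ublock unitrM -!unitmxE uA. Qed.

Lemma unitmx_lblock m n (A : 'M[int]_m) (X : 'M_(n, m)) (D : 'M_n) :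
  A \in unitmx -> D \in unitmx -> block_mx A 0 X D \in unitmx.
Proof. by move=> uA uD; rewrite unitmxE det_lblock unitrM -!unitmxE uA. Qed.

Section BlockMoves.

Variables (m n : nat) (A : 'M[int]_m) (B : 'M[int]_(m, n)).
Variables (C : 'M[int]_(n, m)) (D : 'M[int]_n).

Lemma ueq_add_row1 (X : 'M_(m, n)) : unimodular_equiv (block_mx A B C D)
  (block_mx (A + X *m C) (B + X *m D) C D).
Proof.
have := @ueq_mull _ _ (block_mx 1%:M X 0 1%:M) (block_mx A B C D).
rewrite mulmx_block !mul1mx !mul0mx !add0r.
by apply; rewrite unitmx_ublock ?unitmx1.
Qed.

Lemma ueq_add_row2 (X : 'M_(n, m)) : unimodular_equiv (block_mx A B C D)
  (block_mx A B (C + X *m A) (D + X *m B)).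
Proof.
have := @ueq_mull _ _ (block_mx 1%:M 0 X 1%:M) (block_mx A B C D).
rewrite mulmx_block !mul1mx !mul0mx !addr0 ![X *m _ + _]addrC.
by apply; rewrite unitmx_lblock ?unitmx1.
Qed.

Lemma ueq_add_col1 (X : 'M_(n, m)) : unimodular_equiv (block_mx A B C D)
  (block_mx (A + B *m X) B (C + D *m X) D).
Proof.
have := @ueq_mulr _ _ (block_mx 1%:M 0 X 1%:M) (block_mx A B C D).
rewrite mulmx_block !mulmx1 !mulmx0 !add0r.
by apply; rewrite unitmx_lblock ?unitmx1.
Qed.

Lemma ueq_add_col2 (X : 'M_(m, n)) : unimodular_equiv (block_mx A B C D)
  (block_mx A (B + A *m X) C (D + C *m X)).
Proof.
have := @ueq_mulr _ _ (block_mx 1%:M X 0 1%:M) (block_mx A B C D).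
rewrite mulmx_block !mulmx1 !mulmx0 !addr0 ![_ *m X + _]addrC.
by apply; rewrite unitmx_ublock ?unitmx1.
Qed.

Lemma ueq_diag_rows (P : 'M_m) (Q : 'M_n) : P \in unitmx -> Q \in unitmx ->
  unimodular_equiv (block_mx A B C D)
    (block_mx (P *m A) (P *m B) (Q *m C) (Q *m D)).
Proof.
move=> uP uQ; have := @ueq_mull _ _ (block_mx P 0 0 Q) (block_mx A B C D).
by rewrite mulmx_block !mul0mx !addr0 !add0r; apply; rewrite unitmx_lblock.
Qed.

Lemma ueq_diag_cols (P : 'M_m) (Q : 'M_n) : P \in unitmx -> Q \in unitmx ->
  unimodular_equiv (block_mx A B C D)
    (block_mx (A *m P) (B *m Q) (C *m P) (D *m Q)).
Proof.
move=> uP uQ; have := @ueq_mulr _ _ (block_mx P 0 0 Q) (block_mx A B C D).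
by rewrite mulmx_block !mulmx0 !addr0 !add0r; apply; rewrite unitmx_lblock.
Qed.

End BlockMoves.

Lemma ueq_swap_rows n (A B C D : 'M[int]_n) :
  unimodular_equiv (block_mx A B C D) (block_mx C D A B).
Proof.
have := @ueq_mull _ _ (block_mx 0 1%:M 1%:M 0) (block_mx A B C D).
rewrite mulmx_block !mul1mx !mul0mx !addr0 !add0r; apply.
have /mulmx1_unit[] // : block_mx 0 1%:M 1%:M 0 *m block_mx 0 1%:M 1%:M 0
  = 1%:M :> 'M[int]_(n + n).
by rewrite mulmx_block !mul1mx !mul0mx !addr0 !add0r scalar_mx_block.
Qed.

Lemma ueq_mxsub n (f : 'I_n -> 'I_n) (A : 'M[int]_n) : injective f ->
  unimodular_equiv A (mxsub f f A).
Proof.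
move=> f_inj; pose s := perm f_inj.
have -> : mxsub f f A = perm_mx s *m A *m (perm_mx s)^T.
  rewrite -row_permE tr_perm_mx -col_permE.
  by apply/matrixP => i j; rewrite !mxE !permE.
by exists (perm_mx s), (perm_mx s)^T; rewrite unitmx_tr unitmx_perm.
Qed.

Lemma rank_unimodular_equiv m n (A B : 'M[int]_(m, n)) :
  unimodular_equiv A B ->
  \rank (map_mx intr A : 'M[rat]_(m, n))
  = \rank (map_mx intr B : 'M[rat]_(m, n)).
Proof.
move=> [P [Q [uP uQ ->]]]; rewrite !map_mxM /=.
have mapu k (R : 'M[int]_k) : R \in unitmx ->
    map_mx (intr : int -> rat) R \in unitmx.
  by rewrite !unitmxE det_map_mx => uR; apply: rmorph_unit.
rewrite mxrankMfree ?row_free_unit ?mapu // -[RHS]mxrank_tr trmx_mul.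
by rewrite mxrankMfree ?mxrank_tr // row_free_unit unitmx_tr mapu.
Qed.

(** * Diagonalising the Laplacian of a cyclic strip *)

Section StripLaplacian.

Variable n : nat.

Definition shift_mx : 'M[int]_n := \matrix_(i, j) (j == ordS i)%:R.

(** Both index blocks run over the triangles: the first one stands for the
    spokes, the second one for the rim edges. A spoke lies in two triangles and
    has degree 4; a rim edge lies in one and has degree 2. *)
Definition strip_laplacian : 'M[int]_(n + n) :=
  block_mx (4%:M - shift_mx - shift_mx^T) (- (1%:M + shift_mx^T))
           (- (1%:M + shift_mx)) 2%:M.

Local Notation S := shift_mx.

Lemma mul_shift_mxT : S *m S^T = 1%:M.
Proof.
apply/matrixP => i j; rewrite !mxE (bigD1 (ordS i)) //= !mxE eqxx mul1r.
rewrite big1 ?addr0 => [|k /negPf kN]; first by rewrite (inj_eq (@ordS_inj _)).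
by rewrite !mxE kN mul0r.
Qed.

Lemma mul_shift_mxTl : S^T *m S = 1%:M.
Proof. by apply: mulmx1C; apply: mul_shift_mxT. Qed.

Lemma shift_mx_unit : S \in unitmx.
Proof. by have [] := mulmx1_unit mul_shift_mxT. Qed.

(** As (1 + S^T)(1 + S) = 2 + S + S^T, a multiple of the rim rows clears S from
    the spoke block and leaves 3 (1 - S^T) there. Adding the second block column
    to the first one cancels this and turns -(1 + S) into 1 - S = (S^T - 1) S,
    whose factor S is unimodular. *)
Lemma strip_laplacian_ueq_circulant : unimodular_equiv strip_laplacian
  (block_mx (S^T - 1%:M) 2%:M 0 (3%:M *m (S^T - 1%:M))).
Proof.
have SST := mul_shift_mxT; have STS := mul_shift_mxTl.
apply: ueq_trans (ueq_swap_rows _ _ _ _) _.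
apply: ueq_trans (ueq_add_row2 _ _ _ _ (2%:M *m S^T - 1%:M)) _.
apply: ueq_trans (ueq_add_col1 _ _ _ _ 1%:M) _.
have uT : S^T \in unitmx by rewrite unitmx_tr shift_mx_unit.
set M := block_mx _ _ _ _.
suff -> : block_mx (S^T - 1%:M) 2%:M 0 (3%:M *m (S^T - 1%:M)) =
   M *m block_mx S^T 0 0 1%:M.
  by apply: ueq_mulr; rewrite unitmx_lblock ?unitmx1 // unitmx_tr shift_mx_unit.
rewrite /M mulmx_block !mulmx0 !addr0 !add0r !mulmx1.
congr (block_mx _ _ _ _);
  rewrite !(mulmxDl, mulmxDr, mulNmx, mulmxN, mulmx1, mul1mx, mulmx0);
  rewrite -?mulmxA -?scalemxAl -?scalemxAr ?STS ?SST;
  rewrite ?mul_scalar_mx ?mul_mx_scalar -?scalemxAr ?STS ?SST //.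
all: apply/matrixP => i j; rewrite !mxE; ring.
Qed.

Variables (g p : 'I_n) (p_last : p.+1 = n) (g_penult : g.+1 = p).

(** The rows of the difference operator C = S^T - 1 add up to zero, so the last
    row of ones gives a zero row of U C. Row g uses the decreasing weights
    n - 1, n - 2, ..., 1, 0, which combine the rows of C into n times the last
    coordinate form minus the all-ones form. This puts the all-ones form in
    the span of that single row and of the last coordinate form. *)
Definition rowop_mx : 'M[int]_n := \matrix_(i, j)
  if (i < g)%N then (i == j)%:R else if i == g then (p - j)%:Z else 1.

(** Right multiplication replaces the last column by the sum of all columns;
    this kills the last column of C, since each row of C has sum zero. *)
Definition sumcol_mx : 'M[int]_n :=
  \matrix_(i, j) if j == p then 1 else (i == j)%:R.

(** The nonzero rows of U C B, completed by the last coordinate vector into a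
    basis; the rows are the coordinate forms in which C becomes diagonal. *)
Definition coord_mx : 'M[int]_n := \matrix_(i, j)
  if (i < g)%N then (i == j.+1 :> nat)%:R - (i == j)%:R
  else if i == g then - (j < p)%:R else (j == p)%:R.

Local Notation U := rowop_mx.
Local Notation B := sumcol_mx.
Local Notation T := coord_mx.
Local Notation E := (1%:M - delta_mx p p : 'M[int]_n).

Lemma unitmx_trig (M : 'M[int]_n) : is_trig_mx M ->
  (forall i, M i i \is a GRing.unit) -> M \in unitmx.
Proof.
move=> tM uM; rewrite unitmxE det_trig //.
by elim/big_ind: _ => // x y ux uy; rewrite unitrM ux.
Qed.

Lemma ord_cases (i : 'I_n) : [\/ (i < g)%N, i = g | i = p].
Proof.
have [ig|gi] := ltnP i g; first by constructor 1.
have [->|/eqP ip] := eqVneq i p; first by constructor 3.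
constructor 2; apply: val_inj => /=; have := ltn_ord i.
have : val i <> val p by move=> /val_inj.
move=> /= ip' ii; lia.
Qed.

Lemma gNp : (g == p) = false.
Proof. by rewrite -val_eqE /=; lia. Qed.

Lemma pNg : (p == g) = false.
Proof. by rewrite eq_sym gNp. Qed.

Lemma rowop_mx_unit : U \in unitmx.
Proof.
apply: unitmx_trig => [|i].
  apply/is_trig_mxP => i j ij; rewrite mxE; case: (ord_cases i) => hi.
  - by rewrite hi -val_eqE ltn_eqF.
  - by subst i; rewrite ltnn eqxx; have := ltn_ord j => ?; congr Posz; lia.
  - by subst i; have := ltn_ord j => ?; lia.
rewrite mxE; case: (ord_cases i) => hi.
- by rewrite hi eqxx unitr1.
- by subst i; rewrite ltnn eqxx (_ : p - g = 1)%N ?unitr1 //; lia.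
- by subst i; rewrite pNg ifN ?unitr1 // -leqNgt; lia.
Qed.

Lemma coord_mx_unit : T \in unitmx.
Proof.
apply: unitmx_trig => [|i].
  apply/is_trig_mxP => i j ij; rewrite mxE; case: (ord_cases i) => hi.
  - by rewrite hi -val_eqE /= !ltn_eqF ?subrr //; lia.
  - subst i; rewrite ltnn eqxx; have := ltn_ord j => ?.
    by rewrite (_ : j < p = false)%N ?oppr0 //; lia.
  - by subst i; have := ltn_ord j => ?; lia.
rewrite mxE; case: (ord_cases i) => hi.
- by rewrite hi eqxx ltn_eqF // sub0r unitrN unitr1.
- by subst i; rewrite ltnn eqxx (_ : g < p)%N ?unitrN ?unitr1 //; lia.
- by subst i; rewrite pNg eqxx ifN ?unitr1 // -leqNgt; lia.
Qed.

Lemma sumcol_mx_unit : B \in unitmx.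
Proof.
rewrite -unitmx_tr; apply: unitmx_trig => [|i]; last first.
  by rewrite !mxE eqxx; case: ifP; rewrite unitr1.
apply/is_trig_mxP => i j ij; rewrite !mxE.
have -> : (i == p) = false by rewrite -val_eqE /=; have := ltn_ord j; lia.
by rewrite -val_eqE /= gtn_eqF.
Qed.

Lemma mul_shift_diff (M : 'M[int]_n) (i j : 'I_n) :
  (M *m (S^T - 1%:M)) i j = M i (ordS j) - M i j.
Proof.
rewrite mulmxDr mulmxN mulmx1 !mxE; congr (_ - _).
rewrite (bigD1 (ordS j)) //= !mxE eqxx mulr1 big1 ?addr0 // => k /negPf kN.
by rewrite !mxE kN mulr0.
Qed.

Lemma mul_sumcol (M : 'M[int]_n) (i j : 'I_n) :
  (M *m B) i j = if j == p then \sum_k M i k else M i j.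
Proof.
rewrite !mxE; case: ifP => jp.
  by apply: eq_bigr => k _; rewrite mxE jp mulr1.
rewrite (bigD1 j) //= !mxE eqxx jp mulr1 big1 ?addr0 // => k /negPf kN.
by rewrite !mxE jp kN mulr0.
Qed.

Lemma mul_delta_row (M : 'M[int]_n) (i j a b : 'I_n) :
  (delta_mx a b *m M) i j = (i == a)%:R * M b j.
Proof.
rewrite !mxE (bigD1 b) //= !mxE eqxx andbT big1 ?addr0 // => k /negPf kN.
by rewrite !mxE kN andbF mul0r.
Qed.

Lemma ordS_lt (j : 'I_n) : j != p -> ordS j = j.+1 :> nat.
Proof.
rewrite -val_eqE => jp /=; rewrite modn_small //.
by move: jp (ltn_ord j) => /=; lia.
Qed.

(** Since B and T are unimodular, V = B T^-1 puts C in Smith form: U C V = E. *)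
Lemma diff_factor : U *m (S^T - 1%:M) *m B = E *m T.
Proof.
apply/matrixP => i j; rewrite mul_sumcol mulmxDl mul1mx mulNmx [RHS]mxE.
rewrite [X in _ = _ + X]mxE mul_delta_row.
case: ifP => jp.
  under eq_bigr => k _ do rewrite mul_shift_diff.
  rewrite sumrB [X in X - _](_ : _ = \sum_k U i k) ?subrr; last first.
    by rewrite [RHS](reindex_inj (@ordS_inj n)).
  rewrite !mxE jp (_ : (p < g)%N = false) ?pNg; last by lia.
  rewrite (eqP jp) ltnn mulr1 oppr0.
  case: (ord_cases i) => hi.
  - rewrite hi ltn_eqF; last by lia.
    by rewrite -!val_eqE /= !ltn_eqF ?subrr //; lia.
  - by subst i; rewrite ltnn eqxx gNp subrr.
  - by subst i; rewrite eqxx pNg ifN ?subrr //; lia.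
have jS : ordS j = j.+1 :> nat by apply: ordS_lt; rewrite jp.
rewrite mul_shift_diff; move: (ordS j) jS => k jS; rewrite !mxE.
have jp' : (j < p)%N by move: jp; rewrite -val_eqE /=; have := ltn_ord j; lia.
have pg : (p < g)%N = false by lia.
rewrite jS jp jp' -!val_eqE /= jS !val_eqE pg ?pNg.
case: (ord_cases i) => hi.
- by rewrite hi (_ : (i == p) = false) ?mul0r ?subr0 // -val_eqE /=; lia.
- subst i; rewrite ltnn eqxx gNp mulr0 subr0 -!subzn ?(ltnW jp') // intS.
  by ring.
- by subst i; rewrite pNg pg mulr0 !subrr.
Qed.

(** The last row of U B is (1, ..., 1, n), and it equals n times the last row of
    T minus row g of T. This gives the one row of U V that survives, and it is
    the place where the length of the strip enters. *)
Lemma last_row_factor :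
  delta_mx p p *m (U *m B) = (n%:R *: delta_mx p p - delta_mx p g) *m T.
Proof.
apply/matrixP => i j; rewrite mul_delta_row mulmxDl mulNmx -scalemxAl.
rewrite mul_sumcol [RHS]mxE [X in X + _]mxE [X in _ + X]mxE.
rewrite !mul_delta_row mulrCA -mulrBr.
congr (_ * _); rewrite !mxE ltnn eqxx ?gNp ?pNg.
have pg : (p < g)%N = false by lia.
rewrite pg; case: ifP => jp.
  rewrite (eqP jp) ltnn oppr0 subr0 mulr1.
  under eq_bigr => k _ do rewrite mxE pg pNg.
  by rewrite sumr_const card_ord.
rewrite mulr0 sub0r opprK (_ : (j < p)%N) //.
by move: jp; rewrite -val_eqE /=; have := ltn_ord j; lia.
Qed.

Local Notation d := (fun a b : 'I_n => delta_mx a b : 'M[int]_n).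

(** Multiplying both block rows by U and both block columns by V turns C into E
    but the scalar block 2 into 2UV, not into 2. Column operations with
    the corner E then remove E (2UV), that is, all of its rows but the last. *)
Lemma strip_laplacian_ueq_last_row : unimodular_equiv strip_laplacian
  (block_mx E (2 *: (n%:R *: d p p - d p g)) 0 (3 *: E)).
Proof.
apply: ueq_trans strip_laplacian_ueq_circulant _.
have uU := rowop_mx_unit; have uT := coord_mx_unit.
set V := B *m invmx T.
have uV : V \in unitmx by rewrite unitmx_mul sumcol_mx_unit unitmx_inv.
have UcV : U *m (S^T - 1%:M) *m V = E by rewrite mulmxA diff_factor mulmxK.
have dUV : d p p *m (U *m V) = n%:R *: d p p - d p g.
  by rewrite !mulmxA -(mulmxA (delta_mx _ _)) last_row_factor mulmxK.
apply: ueq_trans (ueq_diag_rows _ _ _ _ uU uU) _.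
apply: ueq_trans (ueq_diag_cols _ _ _ _ uV uV) _.
apply: ueq_trans (ueq_add_col2 _ _ _ _ (- (2 *: (U *m V)))) _.
rewrite !mul_scalar_mx !mulmx0 !mul0mx addr0 -!scalemxAr -!scalemxAl !UcV.
rewrite (_ : _ + E *m _ = 2 *: (d p p *m (U *m V))); last first.
  rewrite mul_mx_scalar -scalemxAl mulmxN -scalemxAr mulmxBl mul1mx scalerBr.
  by rewrite opprB addrC subrK.
by rewrite dUV; apply: ueq_refl.
Qed.

Lemma mul_delta_gp (a b : 'I_n) : d a g *m d p b = 0.
Proof. by rewrite mul_delta_mx_cond gNp. Qed.

Lemma mul_delta_pg (a b : 'I_n) : d a p *m d g b = 0.
Proof. by rewrite mul_delta_mx_cond pNg. Qed.

(* The combinations of the identity and of the elementary matrices on the indices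
   g and p are closed under products; this multiplies them out. *)
Ltac mx_expand :=
  rewrite !(mulmxDl, mulmxDr, mulNmx, mulmxN, mulmx1, mul1mx, mulmx0, mul0mx,
            =^~ scalemxAl, =^~ scalemxAr,
            mul_delta_mx, mul_delta_gp, mul_delta_pg).

(** Only the entries on the indices g and p are coupled. There 3 - 2 = 1
    is a pivot: adding a row with entry 3 to the row with entry -2 creates
    the missing unit, and eliminating with it leaves 6n. *)
Lemma strip_laplacian_ueq_diag : unimodular_equiv strip_laplacian
  (block_mx 1%:M 0 0 (3 *: (1%:M - d g g - d p p) + (6 * n)%:R *: d g g)).
Proof.
apply: ueq_trans strip_laplacian_ueq_last_row _.
set F := d p g + (2 * n)%:R *: d p p.
set G := 3 *: (1%:M - d g g - d p p) - (6 * n)%:R *: d g p.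
have blk (A A' B B' C C' D D' : 'M[int]_n) :
    A = A' -> B = B' -> C = C' -> D = D' ->
    unimodular_equiv (block_mx A B C D) (block_mx A' B' C' D').
  by move=> -> -> -> ->; apply: ueq_refl.
(* The pivot 1 = 3 - 2 appears at the entry (p, g) of the block F. *)
apply: (@ueq_trans _ _ _ (block_mx E F 0 (3 *: E))).
  apply: ueq_trans (ueq_add_row1 _ _ _ _ (d p g)) _; apply: blk => //;
    rewrite ?mulmx0 ?addr0 // /F.
  by apply/matrixP => i j; mx_expand; rewrite !mxE; ring.
(* The pivot clears the 3 below it, and its row leaves -6n at (g, p). *)
apply: (@ueq_trans _ _ _ (block_mx E F 0 G)).
  apply: ueq_trans (ueq_add_row2 _ _ _ _ (- (3%:R *: d g p))) _.
  apply: blk => //; rewrite /F /G; mx_expand;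
    rewrite ?subrr ?scaler0 ?oppr0 ?addr0 //.
  by apply/matrixP => i j; rewrite !mxE; ring.
(* The pivot is copied into the zero column p of E, which becomes 1. *)
apply: (@ueq_trans _ _ _ (block_mx 1%:M F 0 G)).
  apply: ueq_trans (ueq_add_col1 _ _ _ _ (d g p)) _.
  apply: blk => //; rewrite /F /G; mx_expand.
    by apply/matrixP => i j; rewrite !mxE; ring.
  by apply/matrixP => i j; rewrite !mxE; ring.
apply: (@ueq_trans _ _ _ (block_mx 1%:M 0 0 G)).
  apply: ueq_trans (ueq_add_col2 _ _ _ _ (- F)) _.
  by apply: blk => //; rewrite ?mul1mx ?mul0mx ?addr0 ?subrr.
(* A signed transposition moves -6n from the entry (g, p) to 6n at (g, g). *)
pose Z := 1%:M - d g g - d p p + d g p - d p g.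
have uZ : Z \in unitmx.
  have /mulmx1_unit[] // : Z *m Z^T = 1%:M.
  rewrite /Z !linearB /= !linearD /= !linearN /= trmx1 !trmx_delta.
  by apply/matrixP => i j; mx_expand; rewrite !mxE; ring.
apply: ueq_trans (ueq_diag_cols _ _ _ _ (unitmx1 _ _) uZ) _.
apply: blk; rewrite ?mul0mx ?mulmx1 // /G /Z; mx_expand.
by apply/matrixP => i j; rewrite !mxE; ring.
Qed.

End StripLaplacian.

(** * Recognising the Smith normal form *)

Section Snf.

Variables (N M : nat).

Definition strip_snf : 'M[int]_(N + (M + 2)) :=
  dsum_mx (1%:M : 'M[int]_N) (dsum_mx (3%:M : 'M[int]_M)
     (diag_mx (\row_(j < 2) [:: (6 * N)%:Z; 0]`_j))).

Definition strip_invariants := nseq N (1 : int) ++ nseq M 3 ++ [:: (6 * N)%:Z].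

Lemma nth_strip_invariants i : strip_invariants`_i =
  if (i < N)%N then 1 else if (i < N + M)%N then 3 else
  if i == (N + M)%N then (6 * N)%:Z else 0.
Proof.
rewrite /strip_invariants !nth_cat !size_nseq !nth_nseq.
case: ltnP => // Ni; rewrite ltn_subLR //; case: ltnP => // NMi.
case: eqP => [->|ne]; first by rewrite -subnDA subnn.
by rewrite nth_default //=; lia.
Qed.

Lemma strip_snf_diag :
  strip_snf = \matrix_(i, j) (strip_invariants`_i *+ (i == j :> nat)).
Proof.
apply/matrixP => i j; rewrite [RHS]mxE nth_strip_invariants /strip_snf /dsum_mx.
case: (split_ordP i) => {}i ->; case: (split_ordP j) => {}j ->.
- by rewrite block_mxEul mxE.
- by rewrite block_mxEur mxE /= ltn_eqF // ltn_addr.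
- by rewrite block_mxEdl mxE /= [_ == nat_of_ord j]gtn_eqF ?mulr0n // ltn_addr.
rewrite block_mxEdr /= ltn_add2l !eqn_add2l.
case: (split_ordP i) => {}i ->; case: (split_ordP j) => {}j ->.
- by rewrite block_mxEul mxE.
- by rewrite block_mxEur mxE /= ltn_eqF // ltn_addr.
- by rewrite block_mxEdl mxE /= [_ == nat_of_ord j]gtn_eqF ?mulr0n // ltn_addr.
have Mi0 : (M + i == M)%N = (i == 0 :> nat) by lia.
rewrite block_mxEdr !mxE /= !eqn_add2l -val_eqE /= Mi0.
by case: (val i) (ltn_ord i) => [|[]].
Qed.

Lemma rank_strip_snf : (0 < N)%N ->
  \rank (map_mx intr strip_snf : 'M[rat]_(N + (M + 2))) = (N + M).+1.
Proof.
move=> N0; rewrite /strip_snf /dsum_mx !map_block_mx !map_mx0.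
rewrite !rank_diag_block_mx.
rewrite !map_scalar_mx /= -[_%:~R%:M in X in (_ + (X + _))%N]scalemx1.
rewrite mxrank_scale_nz // !mxrank1.
set D := map_mx _ _; suff -> : D = (6 * N)%:R *: delta_mx 0 0.
  by rewrite mxrank_scale_nz ?mxrank_delta ?addnA ?addn1 // pnatr_eq0; lia.
apply/matrixP => i j; rewrite !mxE.
by case: i => [[|[]]] //= ?; case: j => [[|[]]] //= ?; rewrite ?mulr1 ?mulr0.
Qed.

Lemma strip_snfP (L : 'M[int]_(N + (M + 2))) : (0 < N)%N ->
  unimodular_equiv L strip_snf -> is_smith_normal_form L strip_snf.
Proof.
move=> N0 LD; exists strip_invariants.
have sz : size strip_invariants = (N + M).+1.
  by rewrite !size_cat !size_nseq addnA addn1.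
split.
- by rewrite (rank_unimodular_equiv LD) rank_strip_snf.
- move=> i; rewrite sz ltnS nth_strip_invariants; case: ifP => // _.
  by case: ltnP => // NMi iNM; rewrite eqn_leq iNM NMi ltz_nat muln_gt0.
- move=> i j ij; rewrite sz ltnS => jNM; rewrite !nth_strip_invariants.
  have [iN|Ni] := ltnP i N; first by rewrite dvd1z.
  rewrite ifF; last by lia.
  rewrite (_ : i < N + M)%N; last by lia.
  case: ifP => // jNM'; rewrite ifT; last by lia.
  by rewrite dvdzE /= (_ : 6 * N = 3 * (2 * N))%N ?dvdn_mulr //; lia.
- exact: strip_snf_diag.
by have [P [Q [uP uQ e]]] := LD; exists P, Q.
Qed.

End Snf.

Lemma strip_snf_block M (g p : 'I_(M + 2)) :
  p.+1 = (M + 2)%N -> g.+1 = p -> strip_snf (M + 2) M =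
    block_mx 1%:M 0 0 (3 *: (1%:M - delta_mx g g - delta_mx p p)
                       + (6 * (M + 2))%:R *: delta_mx g g).
Proof.
move=> p_last g_pen; rewrite /strip_snf /dsum_mx; congr (block_mx _ _ _ _).
have gE : g = rshift M (0 : 'I_2) by apply: val_inj => /=; lia.
have pE : p = rshift M (1 : 'I_2) by apply: val_inj => /=; lia.
apply/matrixP => i j; rewrite gE pE.
case: (split_ordP i) => {}i ->; case: (split_ordP j) => {}j ->.
- rewrite block_mxEul !mxE !(eq_lshift, eq_lrshift) /= !subr0 mulr0 addr0.
  by rewrite mulr_natr.
- by rewrite block_mxEur !mxE !(eq_lrshift) /= !subr0 !mulr0.
- by rewrite block_mxEdl !mxE !(eq_rlshift, eq_lrshift) /= !andbF !subr0 !mulr0.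
rewrite block_mxEdr !mxE !eq_rshift.
case: i => [[|[]]] //= ?; case: j => [[|[]]] //= ?;
  rewrite ?mulr1 ?mulr0 ?addr0 ?add0r //.
by rewrite natz.
Qed.

Lemma snf_of_ueq_strip N M (h : (N + (M + 2) = N + N)%N) (L : 'M[int]_(N + N)) :
  unimodular_equiv L (strip_laplacian N) ->
  is_smith_normal_form L (castmx (h, h) (strip_snf N M)).
Proof.
have NM : (M + 2 = N)%N by lia.
subst N; rewrite (eq_irrelevance h (erefl _)) castmx_id => Lequiv.
apply: strip_snfP; first by lia.
have g_lt : (M < M + 2)%N by lia.
have p_lt : (M.+1 < M + 2)%N by lia.
apply: ueq_trans Lequiv _.
rewrite (@strip_snf_block M (Ordinal g_lt) (Ordinal p_lt)) //=; last by lia.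
by apply: strip_laplacian_ueq_diag => //=; lia.
Qed.

(** * Complexes whose triangles form a cyclic strip *)

(** The label [inl k] stands for the spoke that triangle k shares with triangle
    k - 1, and [inr k] for the rim edge of triangle k. *)
Definition strip_edges N (k : 'I_N) : seq ('I_N + 'I_N) :=
  [:: inl k; inl (ordS k); inr k].

(** All that the second Laplacian sees of a complex: its edges, its triangles,
    and which edges lie in which triangle. *)
Definition cyclic_strip N (V : finType) (S : simplicial_complex V)
    (e : 'I_N + 'I_N -> {set V}) (t : 'I_N -> {set V}) :=
  [/\ injective e, cliques S 2 = [set e x | x : 'I_N + 'I_N],
      cliques S 3 = [set t k | k : 'I_N]
    & forall x k, (e x \subset t k) = (x \in strip_edges k)].

Definition strip_adj N (x y : 'I_N + 'I_N) : bool :=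
  match x, y with
  | inl i, inl j => (j == ordS i) || (i == ordS j)
  | inl i, inr j | inr j, inl i => (i == j) || (i == ordS j)
  | inr _, inr _ => false
  end.

Lemma ordS_ordS_neq N (i : 'I_N) : (2 < N)%N -> ordS (ordS i) != i.
Proof.
move=> N3; rewrite -val_eqE /= -addn1 modnDml.
have iN := ltn_ord i; have [lt|ge] := ltnP (i.+1 + 1) N.
  by rewrite modn_small //; lia.
have -> : (i.+1 + 1 = (i.+1 + 1 - N) + N)%N by lia.
by rewrite modnDr modn_small; lia.
Qed.

Section CyclicStrip.

Variables (N : nat) (V : finType) (S : simplicial_complex V).
Variables (e : 'I_N + 'I_N -> {set V}) (t : 'I_N -> {set V}).
Hypotheses (N_ge3 : (2 < N)%N) (Se : cyclic_strip S e t).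

Lemma clique_adj_strip x y : clique_adj S 2 (e x) (e y) = strip_adj x y.
Proof.
have [e_inj _ S3 et] := Se.
rewrite /clique_adj (inj_eq e_inj).
have -> : [exists s in allowed S,
           [&& #|s| == 3, e x \subset s & e y \subset s]]
  = [exists k, (x \in strip_edges k) && (y \in strip_edges k)].
  apply/existsP/existsP => [[s /and4P[sS s3 xs ys]]|[k /andP[xk yk]]].
    have : s \in cliques S 3 by rewrite inE sS.
    rewrite S3 => /imsetP[k _ sk]; exists k; by rewrite -!et -sk xs ys.
  have : t k \in cliques S 3 by rewrite S3 imset_f.
  by rewrite inE => /andP[tS t3]; exists (t k); rewrite tS t3 !et xk yk.
have Sneq (k : 'I_N) : (ordS k == k) = false by apply/negbTE/ordS_neq; lia.
apply/andP/idP => [[xy /existsP[k]]|].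
  rewrite !inE => /andP[/or3P[]/eqP xE /or3P[]/eqP yE]; subst x y;
  by rewrite /= ?eqxx ?orbT //; rewrite eqxx in xy.
case: x => i; case: y => j //= /orP[]/eqP ->; split;
  rewrite ?inE ?eqE /= ?Sneq // 1?eq_sym ?Sneq //; apply/existsP.
- by exists i; rewrite !inE !eqxx ?orbT.
- by exists j; rewrite !inE !eqxx ?orbT.
- by exists j; rewrite !inE !eqxx ?orbT.
- by exists j; rewrite !inE !eqxx ?orbT.
- by exists i; rewrite !inE !eqxx ?orbT.
- by exists i; rewrite !inE !eqxx ?orbT.
Qed.

Lemma ordS_eqC (i j : 'I_N) : (i == ordS j) = (j == ord_pred i).
Proof. by rewrite -(inj_eq (@ordS_inj _) j) ord_predK eq_sym. Qed.

Lemma card_ord_pair (i j : 'I_N) (P : pred 'I_N) :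
  P =1 pred2 i j -> i != j -> #|P| = 2%N.
Proof. by move=> /eq_card -> ij; rewrite card2 ij. Qed.

Lemma card_sum_pred (P : pred ('I_N + 'I_N)) :
  #|P| = (#|[pred i | P (inl i)]| + #|[pred i | P (inr i)]|)%N.
Proof. by rewrite -!sum1_card big_sumType. Qed.

Lemma card_strip_adj (x : 'I_N + 'I_N) :
  #|strip_adj x| = if x is inl _ then 4%N else 2%N.
Proof.
rewrite card_sum_pred; case: x => i /=.
  have -> : #|[pred j | (j == ordS i) || (i == ordS j)]| = 2%N.
    apply: (@card_ord_pair (ordS i) (ord_pred i)) => [j|].
      by rewrite /= -(ordS_eqC i j).
    by rewrite -ordS_eqC eq_sym ordS_ordS_neq.
  have -> // : #|[pred j | (i == j) || (i == ordS j)]| = 2%N.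
  apply: (@card_ord_pair i (ord_pred i)) => [j|].
    by rewrite /= (ordS_eqC i j) (eq_sym i).
  by rewrite -ordS_eqC eq_sym ordS_neq //; lia.
have -> : #|[pred j | (j == i) || (j == ordS i)]| = 2%N.
  by apply: (@card_ord_pair i (ordS i)) => //; rewrite eq_sym ordS_neq //; lia.
by rewrite (eq_card0 (fun _ => erefl)).
Qed.

Lemma clique_deg_strip x :
  clique_deg S 2 (e x) = if x is inl _ then 4%N else 2%N.
Proof.
have [e_inj S2 _ _] := Se; rewrite -card_strip_adj -(card_imset _ e_inj).
apply: eq_card => b; rewrite inE S2; apply/andP/imsetP => [[]|[y xy ->]].
  by move=> /imsetP[y _ ->]; rewrite clique_adj_strip => xy; exists y.
by rewrite imset_f // clique_adj_strip.
Qed.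

(** The adjacency relation is a disjunction while the entries of the matrix are
    sums of shifts; they agree because the two disjuncts exclude each other,
    which for two spokes requires N > 2. *)
Lemma strip_laplacian_entry x y :
  (clique_deg S 2 (e x))%:R *+ (x == y) - (clique_adj S 2 (e x) (e y))%:R
  = match x, y with
    | inl i, inl j =>
        4 *+ (i == j) - (j == ordS i)%:R - (i == ordS j)%:R
    | inl i, inr j | inr j, inl i => - ((i == j)%:R + (i == ordS j)%:R)
    | inr i, inr j => 2 *+ (i == j)
    end :> int.
Proof.
rewrite clique_adj_strip clique_deg_strip; case: x y => i [] j //=.
- have Sij : ((j == ordS i) && (i == ordS j)) = false.
    apply/andP => -[/eqP -> /eqP ij].
    by move: (ordS_ordS_neq i N_ge3); rewrite -ij eqxx.
  rewrite -addrA -opprD; congr (_ - _).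
  by move: Sij; case: eqP; case: eqP.
- have Sij : ((i == j) && (i == ordS j)) = false.
    apply/andP => -[/eqP -> /eqP ij].
    by have /eqP[] := @ordS_neq _ j (ltnW N_ge3).
  by rewrite mulr0n sub0r; move: Sij; case: eqP; case: eqP.
- have Sij : ((j == i) && (j == ordS i)) = false.
    apply/andP => -[/eqP -> /eqP ij].
    by have /eqP[] := @ordS_neq _ i (ltnW N_ge3).
  by rewrite mulr0n sub0r; move: Sij; case: eqP; case: eqP.
by rewrite subr0.
Qed.

Lemma size_enum_strip c (alpha : c.-tuple {set V}) :
  enumerates S 2 alpha -> (N + N = c)%N.
Proof.
have [e_inj S2 _ _] := Se; case=> alpha_uniq alphaE.
rewrite -[RHS](size_tuple alpha) -(card_uniqP alpha_uniq) (eq_card alphaE) S2.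
by rewrite card_imset // card_sum !card_ord.
Qed.

(** Reordering the edges permutes rows and columns simultaneously, which is an
    equivalence, so the spokes may be listed first and the rim edges last. *)
Lemma laplacian_mx_ueq_strip (alpha : (N + N).-tuple {set V}) :
  enumerates S 2 alpha ->
  unimodular_equiv (laplacian_mx S 2 alpha) (strip_laplacian N).
Proof.
have [e_inj S2 _ _] := Se; case=> alpha_uniq alphaE.
have mem_alpha i : e (split i) \in alpha by rewrite alphaE S2 imset_f.
have idx_lt i : (index (e (split i)) alpha < N + N)%N.
  by rewrite -[X in (_ < X)%N](size_tuple alpha) index_mem.
pose f i := Ordinal (idx_lt i).
have fE i : tnth alpha (f i) = e (split i).
  by rewrite (tnth_nth set0) nth_index.
have f_inj : injective f.
  by move=> i j /(congr1 (tnth alpha)); rewrite !fE => /e_inj/(can_inj splitK).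
suff <- : mxsub f f (laplacian_mx S 2 alpha) = strip_laplacian N.
  exact: ueq_mxsub.
apply/matrixP => i j; rewrite !mxE !fE (inj_eq f_inj).
rewrite -(can_eq (@splitK N N)) strip_laplacian_entry.
case: (split i) => i'; rewrite mxE; case: (split j) => j'; rewrite !mxE.
- by [].
- by [].
- by rewrite [j' == i']eq_sym.
- by [].
Qed.

End CyclicStrip.

(** * The annulus as a cyclic strip *)

Definition mod_ord m (m_gt0 : (0 < m)%N) (k : nat) : 'I_m :=
  Ordinal (ltn_pmod k m_gt0).

Lemma mod_ord_val m m_gt0 (i : 'I_m) : mod_ord m_gt0 i = i.
Proof. by apply: val_inj; rewrite /= modn_small. Qed.

Lemma mod_ordS m m_gt0 k : mod_ord m_gt0 k.+1 = ordS (mod_ord m_gt0 k) :> 'I_m.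
Proof. by apply: val_inj; rewrite /= -addn1 -modnDml addn1. Qed.

(** Positions along a cycle of length m are taken from 0 to m inclusive, so the
    vertex where the cycle closes up has two names. *)
Lemma modn_eq_le m a b : (0 < m)%N -> (a <= m)%N -> (b <= m)%N ->
  a = b %[mod m] -> [\/ a = b, a = 0%N /\ b = m | a = m /\ b = 0%N].
Proof.
move=> m_gt0 am bm.
have [->|am'] := eqVneq a m; have [->|bm'] := eqVneq b m.
- by constructor 1.
- by rewrite modnn modn_small => [<-|]; [constructor 3 | lia].
- by rewrite modnn modn_small => [->|]; [constructor 2 | lia].
- by rewrite !modn_small => [->| |]; [constructor 1 | lia | lia].
Qed.

Lemma set2_eq (T : finType) (a b c d : T) : [set a; b] = [set c; d] ->
  (a = c /\ b = d) \/ (a = d /\ b = c).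
Proof.
move=> E; have /set2P[] : a \in [set c; d] by rewrite -E set21.
all: have /set2P[] : b \in [set c; d] by rewrite -E set22.
all: have /set2P[] : c \in [set a; b] by rewrite E set21.
all: have /set2P[] : d \in [set a; b] by rewrite E set22.
all: by move=> ? ? ? ?; subst; first [by left | by right].
Qed.

Lemma card2_sub_set3 (T : finType) (s : {set T}) (a b c : T) :
  #|s| = 2%N -> s \subset [set a; b; c] ->
  [\/ s = [set a; b], s = [set a; c] | s = [set b; c]].
Proof.
move=> /eqP/cards2P[x [y [xy ->]]] /subsetP sub.
have := sub x (set21 x y); have := sub y (set22 x y); rewrite !inE -!orbA.
by move=> /or3P[]/eqP yE /or3P[]/eqP xE; subst; rewrite ?eqxx // in xy *;
  [> constructor 1; rewrite setUC | constructor 2; rewrite setUC | constructor 1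
   | constructor 3; rewrite setUC | constructor 2 | constructor 3].
Qed.

Section Annulus.

Variables (n : nat) (n_ge3 : (2 < n)%N).

Lemma n_gt0 : (0 < n)%N. Proof. by lia. Qed.
Lemma double_gt0 : (0 < 2 * n)%N. Proof. by lia. Qed.

Definition v_at k : annulus_vertex n := av (mod_ord n_gt0 k).
Definition u_at k : annulus_vertex n := au (mod_ord double_gt0 k).

Lemma v_at_eq a b : (a <= n)%N -> (b <= n)%N -> v_at a = v_at b ->
  [\/ a = b, a = 0%N /\ b = n | a = n /\ b = 0%N].
Proof. by move=> an bn [] /(modn_eq_le n_gt0 an bn). Qed.

Lemma u_at_eq a b : (a <= 2 * n)%N -> (b <= 2 * n)%N -> u_at a = u_at b ->
  [\/ a = b, a = 0%N /\ b = (2 * n)%N | a = (2 * n)%N /\ b = 0%N].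
Proof. by move=> an bn [] /(modn_eq_le double_gt0 an bn). Qed.

(** Walking along the strip, each triangle moves one end of the current spoke:
    the end on the long cycle moves at two steps out of three, and the end on
    the short cycle moves at the steps k = 1 mod 3. After k steps from
    the spoke {v_0, u_0} the ends are at the positions [vpos k] and [upos k]. *)
Definition vpos k := ((k + 1) %/ 3)%N.
Definition upos k := ((2 * k + 1) %/ 3)%N.

Definition spoke k := [set v_at (vpos k); u_at (upos k)].
Definition rim k :=
  if (k %% 3 == 1)%N then [set v_at (vpos k); v_at (vpos k).+1]
  else [set u_at (upos k); u_at (upos k).+1].

Definition annulus_edge (x : 'I_(3 * n) + 'I_(3 * n)) :=
  match x with inl k => spoke k | inr k => rim k end.
Definition annulus_triangle (k : 'I_(3 * n)) := spoke k :|: rim k.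

Lemma annulus_edge_inj : injective annulus_edge.
Proof.
move=> [k|k] [l|l] /=; rewrite /spoke /rim /vpos /upos;
  have kn := ltn_ord k; have ln := ltn_ord l.
- case/set2_eq => -[] // /v_at_eq pE /u_at_eq qE.
  congr inl; apply: val_inj => /=.
  by case: pE; case: qE; lia.
- by case: ifP => _ /set2_eq[][].
- by case: ifP => _ /set2_eq[][].
case: ifP => rk; case: ifP => rl; case/set2_eq => -[] // pE qE.
all: congr inr; apply: val_inj => /=.
1,2: have {}pE := v_at_eq _ _ pE; have {}qE := v_at_eq _ _ qE.
3,4: have {}pE := u_at_eq _ _ pE; have {}qE := u_at_eq _ _ qE.
all: by case: pE; case: qE; lia.
Qed.

Lemma card_spoke k : #|spoke k| = 2%N.
Proof. by rewrite cards2. Qed.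

Lemma card_rim (k : 'I_(3 * n)) : #|rim k| = 2%N.
Proof.
have kn := ltn_ord k; rewrite /rim; case: ifP => rk; rewrite cards2;
  case: eqP => // -[] /modn_eq_le; rewrite /vpos /upos => E; case: E; lia.
Qed.

Lemma v_at_n : v_at n = v_at 0.
Proof. by congr av; apply: val_inj; rewrite /= modnn mod0n. Qed.

Lemma u_at_2n : u_at (2 * n) = u_at 0.
Proof. by congr au; apply: val_inj; rewrite /= modnn mod0n. Qed.

(** The strip closes up: after 3n steps the walk has gone once around both
    cycles. *)
Lemma spoke_ordS (k : 'I_(3 * n)) : spoke (ordS k) = spoke k.+1.
Proof.
have kn := ltn_ord k; have [e|ne] := eqVneq k.+1 (3 * n)%N; last first.
  by rewrite /= modn_small //; lia.
rewrite /= e modnn /spoke.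
have -> : vpos (3 * n) = n by rewrite /vpos; lia.
have -> : upos (3 * n) = (2 * n)%N by rewrite /upos; lia.
by rewrite v_at_n u_at_2n.
Qed.

Lemma spokeS k : spoke k.+1 =
  if (k %% 3 == 1)%N then [set v_at (vpos k).+1; u_at (upos k)]
  else [set v_at (vpos k); u_at (upos k).+1].
Proof.
by rewrite /spoke; case: ifP => rk; congr [set v_at _; u_at _];
  rewrite /vpos /upos; lia.
Qed.

(** The vertices are ordered so that the first two form spoke k, the first and
    the third form rim edge k, and the last two form spoke k + 1. *)
Lemma annulus_triangleE (k : 'I_(3 * n)) : annulus_triangle k =
  if (k %% 3 == 1)%N then [set v_at (vpos k); u_at (upos k); v_at (vpos k).+1]
  else [set u_at (upos k); v_at (vpos k); u_at (upos k).+1].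
Proof.
rewrite /annulus_triangle /rim /spoke; apply/setP => x.
by case: ifP => rk; rewrite !inE;
  case: (x == v_at _); case: (x == u_at _); rewrite ?orbT.
Qed.

(** A triangle has only three 2-subsets, and they are the three edges listed. *)
Lemma annulus_edge_sub x k :
  (annulus_edge x \subset annulus_triangle k) = (x \in strip_edges k).
Proof.
have card_x : #|annulus_edge x| = 2%N.
  by case: x => i; rewrite /= ?card_spoke ?card_rim.
apply/idP/idP.
  have mem y : annulus_edge x = annulus_edge y ->
      y \in strip_edges k -> x \in strip_edges k.
    by move=> /annulus_edge_inj ->.
  rewrite annulus_triangleE; case: ifP => rk /(card2_sub_set3 card_x)[] E.
  - by apply: (mem (inl k)); rewrite ?inE ?eqxx.
  - by apply: (mem (inr k)); rewrite ?inE ?eqxx ?orbT //= /rim rk.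
  - apply: (mem (inl (ordS k))); rewrite ?inE ?eqxx ?orbT //=.
    by rewrite spoke_ordS spokeS rk setUC.
  - apply: (mem (inl k)); rewrite ?inE ?eqxx //=.
    by rewrite E setUC.
  - by apply: (mem (inr k)); rewrite ?inE ?eqxx ?orbT //= /rim rk.
  - apply: (mem (inl (ordS k))); rewrite ?inE ?eqxx ?orbT //=.
    by rewrite spoke_ordS spokeS rk.
rewrite !inE => /or3P[] /eqP -> /=;
  rewrite /annulus_triangle ?subsetUl ?subsetUr //.
rewrite spoke_ordS spokeS /spoke /rim.
by case: ifP => rk; apply/subsetP => y; rewrite !inE;
  case/orP=> ->; rewrite ?orbT.
Qed.

Lemma v_at_ord (i : 'I_n) : v_at i = av i.
Proof. by rewrite /v_at mod_ord_val. Qed.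

Lemma v_atS k : v_at k.+1 = av (ordS (mod_ord n_gt0 k)).
Proof. by rewrite /v_at mod_ordS. Qed.

Lemma u_atS k : u_at k.+1 = au (ordS (mod_ord double_gt0 k)).
Proof. by rewrite /u_at mod_ordS. Qed.

Lemma u_at_double k : mod_ord double_gt0 (2 * k) = dbl_ord (mod_ord n_gt0 k).
Proof. by apply: val_inj; rewrite /= muln_modr. Qed.

Lemma spoke_graph k : annulus_graph (v_at (vpos k)) (u_at (upos k)).
Proof.
rewrite /annulus_graph /= orbF; apply/or3P.
have [r0|r0] := eqVneq (k %% 3)%N 0%N.
  constructor 2; have -> : upos k = (2 * vpos k)%N by rewrite /upos /vpos; lia.
  by rewrite u_at_double.
have [r1|r1] := eqVneq (k %% 3)%N 1%N.
  constructor 3; have -> : upos k = (2 * vpos k).+1 by rewrite /upos /vpos; lia.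
  by rewrite mod_ordS u_at_double.
constructor 1; rewrite -(inj_eq (@ordS_inj _)) ord_predK -mod_ordS -u_at_double.
have -> // : (upos k).+1 = (2 * vpos k)%N by rewrite /upos /vpos; lia.
Qed.

Lemma annulus_edge_graph x :
  exists a b, annulus_graph a b /\ annulus_edge x = [set a; b].
Proof.
case: x => k /=; last rewrite /rim.
  by exists (v_at (vpos k)), (u_at (upos k)); split=> //; apply: spoke_graph.
case: ifP => _.
  exists (v_at (vpos k)), (v_at (vpos k).+1).
  by rewrite /annulus_graph /= mod_ordS eqxx.
exists (u_at (upos k)), (u_at (upos k).+1).
by rewrite /annulus_graph /= mod_ordS eqxx.
Qed.

Lemma arc_annulus_edge a b :
  annulus_arc a b -> exists x, [set a; b] = annulus_edge x.
Proof.
case: a b => [i|j] [i'|j'] //=.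
- move=> /eqP ->; have kn : (3 * i + 1 < 3 * n)%N by have := ltn_ord i; lia.
  exists (inr (Ordinal kn)); rewrite /= /rim ifT; last by lia.
  have -> : vpos (3 * i + 1) = i by rewrite /vpos; lia.
  by rewrite v_atS v_at_ord mod_ord_val.
- case/or3P => /eqP ->.
  + pose i0 := ord_pred i.
    have kn : (3 * i0 + 2 < 3 * n)%N by have := ltn_ord i0; lia.
    exists (inl (Ordinal kn)); rewrite /= /spoke.
    have -> : vpos (3 * i0 + 2) = i0.+1 by rewrite /vpos; lia.
    have -> : upos (3 * i0 + 2) = (2 * i0).+1 by rewrite /upos; lia.
    rewrite v_atS u_atS u_at_double !mod_ord_val (dbl_ordS n_ge3).
    by rewrite /i0 ord_predK.
  + have kn : (3 * i < 3 * n)%N by have := ltn_ord i; lia.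
    exists (inl (Ordinal kn)); rewrite /= /spoke.
    have -> : vpos (3 * i) = i by rewrite /vpos; lia.
    have -> : upos (3 * i) = (2 * i)%N by rewrite /upos; lia.
    by rewrite v_at_ord /u_at u_at_double mod_ord_val.
  have kn : (3 * i + 1 < 3 * n)%N by have := ltn_ord i; lia.
  exists (inl (Ordinal kn)); rewrite /= /spoke.
  have -> : vpos (3 * i + 1) = i by rewrite /vpos; lia.
  have -> : upos (3 * i + 1) = (2 * i).+1 by rewrite /upos; lia.
  by rewrite v_at_ord u_atS u_at_double mod_ord_val.
(* The long cycle advances at the steps 0 and 2 of each period of three, so its
   j-th edge is crossed at step 3j/2 rounded up. *)
move=> /eqP ->.
have kn : ((3 * j + 1) %/ 2 < 3 * n)%N by have := ltn_ord j; lia.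
exists (inr (Ordinal kn)); rewrite /= /rim ifF; last by lia.
have -> : upos ((3 * j + 1) %/ 2) = j by rewrite /upos; lia.
by rewrite u_atS /u_at mod_ord_val.
Qed.

Lemma annulus_cliques2 : cliques (annulus n_ge3) 2
  = [set annulus_edge x | x : 'I_(3 * n) + 'I_(3 * n)].
Proof.
apply/setP => s; rewrite inE.
apply/andP/imsetP => [[sA /cards2P[a [b [ab sE]]]]|[x _ ->]].
  have /andP[_ cl] := annulus_allowedP n_ge3 sA; rewrite sE in cl *.
  have /forall_inP/(_ b (set22 a b)) := forall_inP cl a (set21 a b).
  rewrite ab => /orP[] arc.
    by have [x ->] := arc_annulus_edge arc; exists x.
  by rewrite setUC; have [x ->] := arc_annulus_edge arc; exists x.
have [a [b [ab ->]]] := annulus_edge_graph x.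
split; first exact: annulus_allowed2.
by rewrite cards2; case: (a =P b) ab => // ->;
  rewrite (annulus_graph_irr n_ge3).
Qed.

(** The spoke and the rim edge are distinct pairs, so their union has more than
    two elements. *)
Lemma card_annulus_triangle k : #|annulus_triangle k| = 3%N.
Proof.
apply/eqP; rewrite eqn_leq; apply/andP; split.
  by rewrite annulus_triangleE; case: ifP => _;
    rewrite -setUA cardsU1 cards2; case: (_ \notin _); case: (_ != _).
rewrite ltnNge; apply/negP => le2.
have sT : spoke k = annulus_triangle k.
  by apply/eqP; rewrite eqEcard subsetUl card_spoke.
have rT : rim k = annulus_triangle k.
  by apply/eqP; rewrite eqEcard subsetUr card_rim.
have /annulus_edge_inj // : annulus_edge (inl k) = annulus_edge (inr k).
by rewrite /= sT rT.
Qed.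

Lemma annulus_cliques3 :
  cliques (annulus n_ge3) 3 = [set annulus_triangle k | k : 'I_(3 * n)].
Proof.
have tri0 (i : 'I_n) (kn : (3 * i < 3 * n)%N) :
    annulus_triangle (Ordinal kn) =
    [set av i; au (dbl_ord i); au (ordS (dbl_ord i))].
  rewrite annulus_triangleE ifF /=; last by lia.
  have -> : vpos (3 * i) = i by rewrite /vpos; lia.
  have -> : upos (3 * i) = (2 * i)%N by rewrite /upos; lia.
  by rewrite u_atS v_at_ord /u_at u_at_double mod_ord_val [X in X :|: _]setUC.
have tri1 (i : 'I_n) (kn : (3 * i + 1 < 3 * n)%N) :
    annulus_triangle (Ordinal kn) =
    [set av i; av (ordS i); au (ordS (dbl_ord i))].
  rewrite annulus_triangleE ifT /=; last by lia.
  have -> : vpos (3 * i + 1) = i by rewrite /vpos; lia.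
  have -> : upos (3 * i + 1) = (2 * i).+1 by rewrite /upos; lia.
  by rewrite u_atS v_at_ord v_atS u_at_double mod_ord_val setUAC.
have tri2 (i : 'I_n) (kn : (3 * i + 2 < 3 * n)%N) :
    annulus_triangle (Ordinal kn) =
    [set av (ordS i); au (ord_pred (dbl_ord (ordS i))); au (dbl_ord (ordS i))].
  rewrite annulus_triangleE ifF /=; last by lia.
  have -> : vpos (3 * i + 2) = i.+1 by rewrite /vpos; lia.
  have -> : upos (3 * i + 2) = (2 * i).+1 by rewrite /upos; lia.
  have -> : (2 * i).+2 = (2 * i.+1)%N by lia.
  rewrite u_atS v_atS /u_at !u_at_double mod_ord_val mod_ordS mod_ord_val.
  by rewrite (dbl_ordS n_ge3) [X in X :|: _]setUC.
apply/setP => s; rewrite inE -[allowed _]/(annulus_allowed n).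
apply/andP/imsetP => [[]|[k _ ->]]; last first.
  rewrite card_annulus_triangle; split=> //; rewrite in_setU; apply/orP; right.
  have kn := ltn_ord k; have in3 : (k %/ 3 < n)%N by lia.
  pose i := Ordinal in3; rewrite !in_setU -orbA; apply/or3P.
  have [r0|r0] := eqVneq (k %% 3)%N 0%N.
    have kE : k = (3 * i)%N :> nat by rewrite /=; lia.
    constructor 2; have k0 : (3 * i < 3 * n)%N by rewrite -kE.
    rewrite (_ : k = Ordinal k0) ?tri0; last by apply: val_inj.
    by apply/imsetP; exists i.
  have [r1|r1] := eqVneq (k %% 3)%N 1%N.
    have kE : k = (3 * i + 1)%N :> nat by rewrite /=; lia.
    constructor 3; have k0 : (3 * i + 1 < 3 * n)%N by rewrite -kE.
    rewrite (_ : k = Ordinal k0) ?tri1; last by apply: val_inj.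
    by apply/imsetP; exists i.
  have kE : k = (3 * i + 2)%N :> nat by rewrite /=; lia.
  constructor 1; have k0 : (3 * i + 2 < 3 * n)%N by rewrite -kE.
  rewrite (_ : k = Ordinal k0) ?tri2; last by apply: val_inj.
  by apply/imsetP; exists (ordS i).
rewrite 2!in_setU -orbA => /or3P[/imsetP[x _ ->]||].
- by rewrite cards1.
- rewrite inE => /existsP[a /existsP[b /andP[_ /eqP ->]]].
  by rewrite cards2; case: (_ != _).
move=> sT _; move: sT; rewrite !in_setU -orbA => /or3P[]/imsetP[i _ ->].
- pose i0 := ord_pred i.
  have kn : (3 * i0 + 2 < 3 * n)%N by have := ltn_ord i0; lia.
  by exists (Ordinal kn) => //; rewrite tri2 /i0 ord_predK.
- have kn : (3 * i < 3 * n)%N by have := ltn_ord i; lia.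
  by exists (Ordinal kn) => //; rewrite tri0.
have kn : (3 * i + 1 < 3 * n)%N by have := ltn_ord i; lia.
by exists (Ordinal kn) => //; rewrite tri1.
Qed.

Lemma annulus_cyclic_strip :
  cyclic_strip (annulus n_ge3) annulus_edge annulus_triangle.
Proof.
split; [exact: annulus_edge_inj | exact: annulus_cliques2
       | exact: annulus_cliques3 | exact: annulus_edge_sub].
Qed.

End Annulus.

Theorem theorem9 (n : nat) (n_ge3 : (3 <= n)%N) (c : nat)
    (alpha : c.-tuple {set annulus_vertex n})
    (alphaP : enumerates (annulus n_ge3) 2 alpha) :
  exists h : (3 * n + ((3 * n - 2) + 2) = c)%N,
    is_smith_normal_form (laplacian_mx (annulus n_ge3) 2 alpha)
      (castmx (h, h)
        (dsum_mx (1%:M : 'M[int]_(3 * n))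
          (dsum_mx (3%:M : 'M[int]_(3 * n - 2))
            (diag_mx (\row_(j < 2) [:: (18 * n)%:Z; 0]`_j))))).
Proof.
have strip := annulus_cyclic_strip n_ge3.
have hc := size_enum_strip strip alphaP; subst c.
have h : (3 * n + (3 * n - 2 + 2) = 3 * n + 3 * n)%N by lia.
exists h; have -> : (18 * n = 6 * (3 * n))%N by lia.
apply: (@snf_of_ueq_strip _ _ h).
by apply: (laplacian_mx_ueq_strip _ strip alphaP); lia.
Qed.
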